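(* Let $\mathbf I=(I,\rightarrow,0)$ be a lattice effect implication algebra and define, for all $x,y\in I$, $x':=x\rightarrow0$, $1:=0'$, and the partial operation $+$ by: $x+y$ is defined if and only if $x\rightarrow y'=1$, and in this case $x+y:=x'\rightarrow y$. Then $(I,+,{}',0,1)$ is a lattice effect algebra whose induced order $\leq$ satisfies $x\leq y$ if and only if $x\rightarrow y=1$, and whose lattice operations satisfy $x\vee y=(x\rightarrow y)\rightarrow y$ and $x\wedge y=(x'\vee y')'$ for all $x,y\in I$.
   Context: An effect algebra is a structure $(E,+,{}',0,1)$ where $E$ is a set, ${}'$ is a unary operation on $E$, $0,1\in E$, and $+$ is a partial binary operation on $E$ such that for all $x,y,z\in E$: (E1) if $x+y$ is defined then so is $y+x$ and $x+y=y+x$; (E2) $(x+y)+z$ is defined if and only if $x+(y+z)$ is defined, and then they are equal; (E3) $x+y$ is defined and equals $1$ if and only if $y=x'$; (E4) if $1+x$ is defined then $x=0$. The induced order is $x\leq y$ iff there exists $z$ with $x+z=y$. A lattice effect algebra is an effect algebra whose induced order is a lattice order. A lattice effect implication algebra is an algebra $(I,\rightarrow,0)$ with a binary operation $\rightarrow$ and a constant $0$ such that, writing $x':=x\rightarrow0$ and $1:=0'$, for all $x,y,z\in I$: (i) $0\rightarrow x=x\rightarrow x=x\rightarrow1=1$; (ii) if $x\rightarrow y=y\rightarrow x=1$ then $x=y$; (iii) if $x\rightarrow y=y\rightarrow z=1$ then $x\rightarrow z=1$; (iv) if $x\rightarrow y=1$ then $y'\rightarrow x'=1$; (v) $x''=x$;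 (vi) $x\rightarrow((x\rightarrow y)\rightarrow y)=1$; (vii) $y\rightarrow((x\rightarrow y)\rightarrow y)=1$; (viii) if $x\rightarrow z=y\rightarrow z=1$ then $((x\rightarrow y)\rightarrow y)\rightarrow z=1$; (ix) if $x\rightarrow y=1$ then $y\rightarrow x=x'\rightarrow y'$; (x) [$x\rightarrow y'=1$ and $(x'\rightarrow y)\rightarrow z'=1$] if and only if [$y\rightarrow z'=1$ and $x\rightarrow(y'\rightarrow z)'=1$], and in this case $(x'\rightarrow y)'\rightarrow z=x'\rightarrow(y'\rightarrow z)$; (xi) $y'\rightarrow((x\rightarrow y)\rightarrow y)'=x\rightarrow y$; (xii) $x\rightarrow(y\rightarrow x)=1$.
   Formalization: In axiom (x) the final identity is taken as (x'→y)'→z = x'→(y'→z), with x' instead of x on the right; as printed, x=y=z=0 gives 0=1, so only the one-element algebra would satisfy the axioms. *)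

(* Defs.v *)
From Corelib Require Import Relation_Definitions.
From mathcomp Require Import all_boot.
From mathcomp Require Import boolp.
Set Implicit Arguments.
Unset Strict Implicit.
Unset Printing Implicit Defensive.

Record partial_algebra := PartialAlgebra {
  ea_sort :> Type;
  ea_add : ea_sort -> ea_sort -> option ea_sort; (* [None]: sum undefined *)
  ea_compl : ea_sort -> ea_sort;
  ea_zero : ea_sort;
  ea_one : ea_sort
}.

(* In [ea_addA], both sides are [None] exactly when the corresponding iterated
   sum is undefined, so the equation is Kleene equality. *)
Record is_effect_algebra (E : partial_algebra) : Prop := IsEffectAlgebra {
  ea_addC : forall x y s : E, ea_add x y = Some s -> ea_add y x = Some s;
  ea_addA : forall x y z : E,
    obind (fun s => ea_add s z) (ea_add x y) =
    obind (fun t => ea_add x t) (ea_add y z);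
  ea_complP : forall x y : E,
    ea_add x y = Some (ea_one E) <-> y = ea_compl x;
  ea_add1 : forall x : E, isSome (ea_add (ea_one E) x) -> x = ea_zero E
}.

Definition ea_le (E : partial_algebra) (x y : E) : Prop :=
  exists z : E, ea_add x z = Some y.

Definition is_join (T : Type) (le : T -> T -> Prop) (x y j : T) : Prop :=
  [/\ le x j, le y j & forall z, le x z -> le y z -> le j z].

Definition is_meet (T : Type) (le : T -> T -> Prop) (x y m : T) : Prop :=
  [/\ le m x, le m y & forall z, le z x -> le z y -> le z m].

Definition is_lattice_order (T : Type) (le : T -> T -> Prop) : Prop :=
  [/\ Relation_Definitions.order T le,
      forall x y, exists j, is_join le x y j &
      forall x y, exists m, is_meet le x y m].

Definition is_lattice_effect_algebra (E : partial_algebra) : Prop :=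
  is_effect_algebra E /\ is_lattice_order (@ea_le E).

Record implication_algebra := ImplicationAlgebra {
  ia_sort :> Type;
  imp : ia_sort -> ia_sort -> ia_sort;
  ia_zero : ia_sort
}.

Definition neg (I : implication_algebra) (x : I) : I := imp x (ia_zero I).
Definition ia_one (I : implication_algebra) : I := neg (ia_zero I).

Declare Scope implication_scope.
Delimit Scope implication_scope with imp.
Notation "x ~> y" := (imp x y)
  (at level 55, right associativity) : implication_scope.
Notation "0" := (ia_zero _) : implication_scope.
Notation "1" := (ia_one _) : implication_scope.
Local Open Scope implication_scope.

Record is_lattice_effect_implication_algebra (I : implication_algebra) : Prop :=
  IsLatticeEffectImplicationAlgebra {
  leia_i : forall x : I, [/\ 0 ~> x = 1, x ~> x = 1 & x ~> 1 = 1];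
  leia_ii : forall x y : I, x ~> y = 1 -> y ~> x = 1 -> x = y;
  leia_iii : forall x y z : I, x ~> y = 1 -> y ~> z = 1 -> x ~> z = 1;
  leia_iv : forall x y : I, x ~> y = 1 -> neg y ~> neg x = 1;
  leia_v : forall x : I, neg (neg x) = x;
  leia_vi : forall x y : I, x ~> ((x ~> y) ~> y) = 1;
  leia_vii : forall x y : I, y ~> ((x ~> y) ~> y) = 1;
  leia_viii : forall x y z : I,
    x ~> z = 1 -> y ~> z = 1 -> ((x ~> y) ~> y) ~> z = 1;
  leia_ix : forall x y : I, x ~> y = 1 -> y ~> x = neg x ~> neg y;
  leia_x : forall x y z : I,
    (x ~> neg y = 1 /\ (neg x ~> y) ~> neg z = 1 <->
     y ~> neg z = 1 /\ x ~> neg (neg y ~> z) = 1) /\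
    (x ~> neg y = 1 /\ (neg x ~> y) ~> neg z = 1 ->
     neg (neg x ~> y) ~> z = neg x ~> (neg y ~> z));
  leia_xi : forall x y : I, neg y ~> neg ((x ~> y) ~> y) = x ~> y;
  leia_xii : forall x y : I, x ~> (y ~> x) = 1
}.

Definition imp_add (I : implication_algebra) (x y : I) : option I :=
  if `[< x ~> neg y = 1 >] then Some (neg x ~> y) else None.

Definition effect_algebra_of (I : implication_algebra) : partial_algebra :=
  PartialAlgebra (@imp_add I) (@neg I) (ia_zero I) (ia_one I).

Definition imp_join (I : implication_algebra) (x y : I) : I := (x ~> y) ~> y.

(* Main.v *)
Require Import Defs.
From mathcomp Require Import all_boot.
From mathcomp Require Import boolp.
Set Implicit Arguments.
Unset Strict Implicit.
Unset Printing Implicit Defensive.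
Local Open Scope implication_scope.

(* The relation x ~> y = 1 is a partial order with antitone involution neg and
   joins imp_join; axioms (ix), (x) and (xii) yield commutativity,
   associativity and x <= x + z.  The one substantial point is that x <= y has
   a witness for the induced order, namely the complement of y ~> x: axiom (xi)
   gives x + (y ~> x)' = (y ~> x) ~> x, the join of x and y. *)

Lemma imp_refl (I : implication_algebra)
    (hI : is_lattice_effect_implication_algebra I) (x : I) : x ~> x = 1.
Proof. by case: (leia_i hI x). Qed.

Lemma neg_one (I : implication_algebra)
    (hI : is_lattice_effect_implication_algebra I) : neg 1 = 0 :> I.
Proof. exact: leia_v hI 0. Qed.

Lemma imp_negC (I : implication_algebra)
    (hI : is_lattice_effect_implication_algebra I) (x y : I) :
  x ~> neg y = 1 -> y ~> neg x = 1.
Proof. by move/(leia_iv hI); rewrite (leia_v hI). Qed.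

Lemma neg_impC (I : implication_algebra)
    (hI : is_lattice_effect_implication_algebra I) (x y : I) :
  neg x ~> y = 1 -> neg y ~> x = 1.
Proof. by move/(leia_iv hI); rewrite (leia_v hI). Qed.

(** When [x ~> y = 1], [y] bounds both arguments, so (viii) puts the join below [y]; antisymmetry
    does the rest. This later collapses the joins that occur in (xi). *)
Lemma imp_join_idr (I : implication_algebra)
    (hI : is_lattice_effect_implication_algebra I) (x y : I) :
  x ~> y = 1 -> imp_join y x = y.
Proof.
move=> xy; apply: (leia_ii hI); last exact: leia_vi hI y x.
exact: (leia_viii hI (imp_refl hI y) xy).
Qed.

Lemma imp_addP (I : implication_algebra) (x y s : I) :
  imp_add x y = Some s <-> x ~> neg y = 1 /\ neg x ~> y = s.
Proof.
rewrite /imp_add; case: asboolP => xy; split=> //.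
- by case=> <-.
- by case=> _ ->.
- by case.
Qed.

Lemma imp_addC (I : implication_algebra)
    (hI : is_lattice_effect_implication_algebra I) (x y s : I) :
  imp_add x y = Some s -> imp_add y x = Some s.
Proof.
move=> /imp_addP[xy <-]; apply/imp_addP; split; first exact: imp_negC.
(* Axiom (ix) for x <= y' reads y' ~> x = x' ~> y''. *)
by rewrite (leia_ix hI xy) (leia_v hI).
Qed.

Lemma imp_addA (I : implication_algebra)
    (hI : is_lattice_effect_implication_algebra I) (x y z : I) :
  obind (fun s => imp_add s z) (imp_add x y) =
  obind (fun t => imp_add x t) (imp_add y z).
Proof.
have [[defl defr] eqlr] := leia_x hI x y z.
(* The equivalence in (x) refutes every case where only one side is defined; its equation settles
   the case where both are. *)
rewrite /imp_add; case: asboolP => xy; case: asboolP => yz //=.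
- case: asboolP => xyz; case: asboolP => x_yz //.
  + by rewrite eqlr.
  + by case: (defl (conj xy xyz)).
  + by case: (defr (conj yz x_yz)).
- by case: asboolP => // xyz; case: (defl (conj xy xyz)).
- by case: asboolP => // x_yz; case: (defr (conj yz x_yz)).
Qed.

Lemma effect_algebra_of_leia (I : implication_algebra)
    (hI : is_lattice_effect_implication_algebra I) :
  is_effect_algebra (effect_algebra_of I).
Proof.
split=> /=; [exact: imp_addC | exact: imp_addA | move=> x y | move=> x].
(* Definedness gives x <= y', while the value 1 gives x' <= y, hence y' <= x; antisymmetry yields x
   = y'. *)
- split=> [/imp_addP[xy /(neg_impC hI) yx] | ->].
    by rewrite -(leia_ii hI yx xy) (leia_v hI).
  by apply/imp_addP; rewrite (leia_v hI) !(imp_refl hI).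
(* Definedness of 1 + x says 1 <= x', which forces x' = 1. *)
- rewrite /imp_add; case: asboolP => // le1 _.
  have [_ _ ge1] := leia_i hI (neg x).
  by rewrite -(leia_v hI x) (leia_ii hI ge1 le1) neg_one.
Qed.

(** An equality of relations lets a single rewrite transfer all order and lattice claims. *)
Lemma ea_leE (I : implication_algebra)
    (hI : is_lattice_effect_implication_algebra I) :
  @ea_le (effect_algebra_of I) = (fun x y : I => x ~> y = 1).
Proof.
apply/funext => x; apply/funext => y; apply/propext; split=> [[z] | xy].
  (* Commuting the sum writes [y] as [neg z ~> x], the form (xii) needs. *)
  by move=> /(imp_addC hI)/imp_addP[_ <-]; apply: leia_xii.
exists (neg (y ~> x)); apply/imp_addP; rewrite (leia_v hI).
split; first exact: leia_xii.
have joinyx : (y ~> x) ~> x = y := imp_join_idr hI xy.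
(* Both sides of this instance of (xi) contain [(y ~> x) ~> x]; replacing it by [y] leaves
   [neg x ~> neg (y ~> x) = y]. *)
by have := leia_xi hI (y ~> x) x; rewrite joinyx.
Qed.

Lemma imp_joinP (I : implication_algebra)
    (hI : is_lattice_effect_implication_algebra I) (x y : I) :
  is_join (fun a b : I => a ~> b = 1) x y (imp_join x y).
Proof. by split=> [||z]; [apply: leia_vi|apply: leia_vii|apply: leia_viii]. Qed.

(** De Morgan duality: an antitone involution carries joins to meets. *)
Lemma imp_meetP (I : implication_algebra)
    (hI : is_lattice_effect_implication_algebra I) (x y : I) :
  is_meet (fun a b : I => a ~> b = 1) x y (neg (imp_join (neg x) (neg y))).
Proof.
have [jx jy jmin] := imp_joinP hI (neg x) (neg y).
split=> [||z zx zy]; try exact: neg_impC.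
by apply: (imp_negC hI); apply: jmin; apply: leia_iv.
Qed.

Theorem theorem2p5 (I : implication_algebra)
    (hI : is_lattice_effect_implication_algebra I) :
  [/\ is_lattice_effect_algebra (effect_algebra_of I),
      forall x y : I, @ea_le (effect_algebra_of I) x y <-> x ~> y = 1,
      forall x y : I, is_join (@ea_le (effect_algebra_of I)) x y (imp_join x y) &
      forall x y : I, is_meet (@ea_le (effect_algebra_of I)) x y
                        (neg (imp_join (neg x) (neg y)))].
Proof.
rewrite /is_lattice_effect_algebra (ea_leE hI).
split=> //; [split | exact: imp_joinP | exact: imp_meetP].
  exact: effect_algebra_of_leia.
split=> [|x y|x y].
- split; [exact: imp_refl | exact: leia_iii | exact: leia_ii].
- by exists (imp_join x y); apply: imp_joinP.
- by exists (neg (imp_join (neg x) (neg y))); apply: imp_meetP.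
Qed.
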